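(* Let $\alpha\ge 1$, $b\ge \alpha+1$ and $\ell\ge 0$ be integers, let $k=(1+\alpha)^\ell$, and assume $b\equiv 2+\alpha \pmod{2+2\alpha}$. Define $N_k=[(1\alpha)^{\wedge k}]_b$, i.e. the integer whose base $b$ representation is the two-digit string $1,\alpha$ repeated $k$ times. Then there exists an integer $M\ge 0$ such that $$s_b(N_k)\cdot M=(s_b(N_k)\cdot M)^R=\frac{N_k}{2}.$$ In particular, all the numbers $N_k$ (for $k=(1+\alpha)^\ell$, $\ell\ge 0$) are $b$-ARH numbers and $b$-Niven numbers.
   Context: Let $b\ge 2$ be a numeration base. For a string $x$ of base $b$ digits, $(x)^{\wedge k}$ is the string obtained by repeating $x$ $k$ times, and $[x]_b$ is the integer represented by the string $x$ in base $b$. $s_b(N)$ is the sum of the base $b$ digits of $N$. The reversal $N^R$ of a nonnegative integer $N$ is the integer obtained by writing the base $b$ digits of $N$ (without leading zeros) in reverse order, i.e. if $N=\sum_{i=0}^{d-1} n_i b^i$ with $0\le n_i<b$, $n_{d-1}\neq 0$, then $N^R=\sum_{i=0}^{d-1} n_i b^{d-1-i}$ (and $0^R=0$). A positive integer $N$ is a $b$-ARH ($b$-additive Ramanujan-Hardy) number if there is a nonnegative integer $M$ (an additive multiplier) such that $N=s_b(N)M+(s_b(N)M)^R$. A positive integer $N$ is a $b$-Niven number if $s_b(N)$ divides $N$. *)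

(* Defs.v *)
From mathcomp Require Import all_boot.

Set Implicit Arguments.
Unset Strict Implicit.
Unset Printing Implicit Defensive.

(* [0] has no digits, so that its digit sum and its reversal are [0]. *)
Definition num_digits (b N : nat) : nat :=
  if N == 0 then 0 else (trunc_log b N).+1.

(* Digits are indexed from the least significant one, [digit b N 0]. *)
Definition digit (b N i : nat) : nat := (N %/ b ^ i) %% b.

Definition digit_sum (b N : nat) : nat :=
  \sum_(i < num_digits b N) digit b N i.

Definition reversal (b N : nat) : nat :=
  \sum_(i < num_digits b N) digit b N i * b ^ ((num_digits b N).-1 - i).

(* Strings are written with the most significant digit first. *)
Definition string_val (b : nat) (x : seq nat) : nat :=
  foldl (fun n d => n * b + d) 0 x.

Definition string_repeat (x : seq nat) (k : nat) : seq nat :=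
  flatten (nseq k x).

Definition is_ARH (b N : nat) : Prop :=
  0 < N /\
  exists M : nat, N = digit_sum b N * M + reversal b (digit_sum b N * M).

Definition is_Niven (b N : nat) : Prop :=
  0 < N /\ digit_sum b N %| N.

Definition N_ (alpha b k : nat) : nat :=
  string_val b (string_repeat [:: 1; alpha] k).

(* Main.v *)
Require Import Defs.
From mathcomp Require Import all_boot.
From mathcomp Require Import zify.

(** Put a = 1 + alpha.  The congruence on b says that b is 1 modulo a and that
    b + alpha is an even multiple of a.  Summing the blocks of the string gives
      N_k = (b + alpha) * S,   S = 1 + b^2 + ... + b^(2(k-1)),
    so N_k is even, and since c = (b + alpha) / 2 is smaller than b, the
    expansion of N_k / 2 = c * S is c 0 c 0 ... 0 c, a palindrome.

    The digit sum of N_k is a * k = a^(l+1), and it divides N_k / 2: the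
    factor c is a multiple of a, while S is a geometric sum with a^l terms and
    ratio b^2 congruent to 1 modulo a, hence a multiple of a^l
    ([dvdn_geometric_sum]).  Thus N_k / 2 is a palindromic multiple of the
    digit sum, and N_k = N_k / 2 + N_k / 2 exhibits N_k as both an ARH and a
    Niven number.

    Digit sums and reversals are read off from explicit expansions by
    uniqueness of base b digits ([digit_expansion],
    [num_digits_expansion]). *)

Definition expansion (b d : nat) (f : nat -> nat) : nat :=
  \sum_(i < d) f i * b ^ i.

(** The digits of the strings above depend only on the parity of the
    position. *)
Definition alternating (u v i : nat) : nat := if odd i then v else u.

Lemma expansion_recl b d f :
  expansion b d.+1 f = expansion b d (fun i => f i.+1) * b + f 0.
Proof.
rewrite /expansion big_ord_recl expn0 muln1 addnC big_distrl /=.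
by congr (_ + _); apply: eq_bigr => i _; rewrite /bump /= add1n expnSr mulnA.
Qed.

Lemma expansion_lt b d f : (forall i, f i < b) -> expansion b d f < b ^ d.
Proof.
elim: d f => [|d IHd] f ltfb; first by rewrite /expansion big_ord0.
rewrite expansion_recl expnSr.
have := IHd (fun i => f i.+1) (fun i => ltfb i.+1); have := ltfb 0; nia.
Qed.

Lemma digit_expansion b d f i :
  (forall j, f j < b) -> i < d -> digit b (expansion b d f) i = f i.
Proof.
rewrite /digit; elim: i d f => [|i IHi] [|d] f ltfb // lt_id.
  by rewrite expansion_recl divn1 modnMDl modn_small.
have b_gt0 : 0 < b by apply: leq_ltn_trans (ltfb 0).
rewrite expansion_recl expnS divnMA divnMDl // (divn_small (ltfb 0)) addn0.
exact: IHi.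
Qed.

Lemma num_digits_expansion b d f :
  1 < b -> (forall i, f i < b) -> 0 < f d ->
  num_digits b (expansion b d.+1 f) = d.+1.
Proof.
move=> b_gt1 ltfb fd_gt0.
have ge_bd : b ^ d <= expansion b d.+1 f.
  by rewrite /expansion big_ord_recr /=; nia.
rewrite /num_digits ifN_eq; last first.
  by rewrite -lt0n (leq_trans _ ge_bd) // expn_gt0 (ltnW b_gt1).
by rewrite (@trunc_log_eq b d) // ge_bd expansion_lt.
Qed.

Lemma digit_sum_expansion b d f :
  1 < b -> (forall i, f i < b) -> 0 < f d ->
  digit_sum b (expansion b d.+1 f) = \sum_(i < d.+1) f i.
Proof.
move=> b_gt1 ltfb fd_gt0; rewrite /digit_sum num_digits_expansion //.
by apply: eq_bigr => i _; rewrite digit_expansion.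
Qed.

Lemma reversal_palindrome b d f :
  1 < b -> (forall i, f i < b) -> 0 < f d ->
  (forall i, i <= d -> f (d - i) = f i) ->
  reversal b (expansion b d.+1 f) = expansion b d.+1 f.
Proof.
move=> b_gt1 ltfb fd_gt0 pal; rewrite /reversal num_digits_expansion //=.
rewrite [RHS](reindex_inj rev_ord_inj) /=; apply: eq_bigr => i _.
by rewrite digit_expansion // subSS pal // -ltnS.
Qed.

Lemma alternating_lt b u v i : u < b -> v < b -> alternating u v i < b.
Proof. by rewrite /alternating; case: odd. Qed.

Lemma expansion_alternating b k u v :
  expansion b k.*2 (alternating u v) = (v * b + u) * \sum_(i < k) (b ^ 2) ^ i.
Proof.
elim: k => [|k IHk]; first by rewrite /expansion !big_ord0 muln0.
rewrite doubleS /expansion !big_ord_recr /= -/(expansion _ _ _) IHk.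
rewrite /alternating /= odd_double /= -expnM mul2n (expnS b k.*2).
by rewrite mulnDr -addnA; congr (_ + _); rewrite mulnDl addnC mulnA.
Qed.

Lemma sum_alternating k u v :
  \sum_(i < k.*2) alternating u v i = (u + v) * k.
Proof.
elim: k => [|k IHk]; first by rewrite big_ord0 muln0.
rewrite doubleS !big_ord_recr /= IHk /alternating /= odd_double /=.
by rewrite -addnA mulnSr.
Qed.

Lemma N_S alpha b k : N_ alpha b k.+1 = (N_ alpha b k * b + 1) * b + alpha.
Proof.
rewrite /N_ /string_val /string_repeat -addn1 nseqD flatten_cat foldl_cat.
by [].
Qed.

Lemma N_expansion alpha b k :
  N_ alpha b k = expansion b k.*2 (alternating alpha 1).
Proof.
elim: k => [|k IHk]; first by rewrite /expansion big_ord0.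
rewrite N_S IHk doubleS !expansion_recl; congr ((_ * b + 1) * b + alpha).
by apply: eq_bigr => i _; rewrite /alternating /= negbK.
Qed.

Lemma geometric_sumM x m n :
  \sum_(i < m * n) x ^ i = (\sum_(i < m) x ^ i) * \sum_(j < n) (x ^ m) ^ j.
Proof.
elim: n => [|n IHn]; first by rewrite muln0 !big_ord0 muln0.
rewrite mulnSr big_split_ord /= IHn big_ord_recr /= mulnDr; congr (_ + _).
by rewrite big_distrl; apply: eq_bigr => i _; rewrite /= expnD expnM mulnC.
Qed.

(** Grouping the terms by blocks factors the sum into l geometric sums of a
    terms each, whose ratios are powers of x; each of them is a sum of a ones
    modulo a. *)
Lemma dvdn_geometric_sum a x l :
  x = 1 %[mod a] -> a ^ l %| \sum_(i < a ^ l) x ^ i.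
Proof.
move=> x1; elim: l => [|l IHl]; first exact: dvd1n.
rewrite expnSr geometric_sumM dvdn_mul // /dvdn -modn_summ.
rewrite (eq_bigr (fun=> 1 %% a)) => [|j _]; last first.
  by rewrite -expnM -modnXm x1 modnXm exp1n.
by rewrite modn_summ sum1_card card_ord modnn.
Qed.

Theorem theorem1 (alpha b l k : nat)
    (halpha : 1 <= alpha) (hb : alpha + 1 <= b)
    (hk : k = (1 + alpha) ^ l)
    (hmod : b = 2 + alpha %[mod 2 + 2 * alpha]) :
  (exists M : nat,
     [/\ digit_sum b (N_ alpha b k) * M
           = reversal b (digit_sum b (N_ alpha b k) * M),
         2 %| N_ alpha b k
       & reversal b (digit_sum b (N_ alpha b k) * M) = N_ alpha b k %/ 2])
  /\ is_ARH b (N_ alpha b k)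
  /\ is_Niven b (N_ alpha b k).
Proof.
have [t bE] : exists t, b = t * (2 + 2 * alpha) + (2 + alpha).
  exists (b %/ (2 + 2 * alpha)).
  by rewrite {1}(divn_eq b (2 + 2 * alpha)) hmod [X in _ + X]modn_small //; lia.
have b_gt1 : 1 < b by lia.
have k_gt0 : 0 < k by rewrite hk expn_gt0.
pose c := (1 + alpha) * t.+1.
have cE : b + alpha = 2 * c by rewrite /c; nia.
have ltcb : c < b by lia.
have c_gt0 : 0 < c by rewrite muln_gt0.
have k2E : k.*2 = k.-1.*2.+2 by rewrite -doubleS prednK.
pose S := \sum_(i < k) (b ^ 2) ^ i.
have NE : N_ alpha b k = 2 * (c * S).
  by rewrite N_expansion expansion_alternating mul1n cE mulnA.
have sE : digit_sum b (N_ alpha b k) = (1 + alpha) * k.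
  rewrite N_expansion k2E digit_sum_expansion //.
  - by rewrite -k2E sum_alternating (addnC alpha).
  - by move=> i; apply: alternating_lt; lia.
  - by rewrite /alternating /= odd_double.
(* Dropping the leading zero leaves the palindrome c 0 c ... 0 c. *)
have HE : c * S = expansion b k.-1.*2.+1 (alternating c 0).
  rewrite -(add0n c) -(mul0n b) -expansion_alternating k2E.
  by rewrite /expansion big_ord_recr /= /alternating /= odd_double addn0.
have revH : reversal b (c * S) = c * S.
  rewrite HE reversal_palindrome //.
  - by move=> i; apply: alternating_lt; lia.
  - by rewrite /alternating odd_double.
  - by move=> i le_i; rewrite /alternating oddB // odd_double.
have /dvdnP[M ME] : digit_sum b (N_ alpha b k) %| c * S.
  rewrite sE dvdn_mul ?dvdn_mulr // hk /S hk dvdn_geometric_sum //.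
  have b1 : b = 1 %[mod 1 + alpha].
    by rewrite (_ : b = (2 * t + 1) * (1 + alpha) + 1) ?modnMDl //; nia.
  by rewrite -modnXm b1 modnXm exp1n.
rewrite [RHS]mulnC in ME.
have N_gt0 : 0 < N_ alpha b k.
  rewrite NE muln_gt0 (muln_gt0 c) c_gt0 /S -(prednK k_gt0) big_ord_recl.
  by [].
split; last split.
- by exists M; rewrite -ME revH NE dvdn_mulr // mulKn.
- by split=> //; exists M; rewrite -ME revH NE mul2n addnn.
- by split=> //; rewrite [X in _ %| X]NE ME mulnCA dvdn_mulr.
Qed.
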